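(* Let $\theta$ be a complex Garsia number whose minimal polynomial has constant term $\pm2$, and let $\lambda=1/\theta$. Then $\nu_\lambda$ is absolutely continuous with respect to two-dimensional Lebesgue measure $\mathcal L_2$, with a bounded density.
   Context: An algebraic integer $\theta$ with $|\theta|>1$ is a Garsia number if all its Galois conjugates have modulus greater than one; a complex Garsia number is a non-real Garsia number. $\nu_\lambda$ is the distribution of the random series $\sum_{n\ge0}\pm\lambda^n$ with signs chosen independently with probability $1/2$ each (a probability measure on $\mathbb C\cong\mathbb R^2$). *)

(* Defs.v *)
(* Complex numbers are `complex R` (= R[i]) from
   mathcomp-real-closed, for an arbitrary `R : realType`; C is identified
   with R^2 = R * R via (Re, Im), carrying the product Borel sigma-algebra
   and the product Lebesgue measure L2 = lebesgue_measure \x lebesgue_measure. *)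
From HB Require Import structures.
From mathcomp Require Import all_boot all_order all_algebra.
From mathcomp Require Import all_classical all_reals all_analysis.
From mathcomp Require Import complex.
Set Implicit Arguments.
Unset Strict Implicit.
Unset Printing Implicit Defensive.
Import Order.TTheory GRing.Theory Num.Theory.
Import numFieldNormedType.Exports.
Local Open Scope classical_set_scope.
Local Open Scope ring_scope.

Section Defs.
Variable R : realType.

Definition int_minpoly (p : {poly int}) (theta : R[i]) : Prop :=
  [/\ p \is monic,
      irreducible_poly (map_poly intr p : {poly rat})
    & root (map_poly intr p) theta].

Definition galois_conjugate (theta z : R[i]) : Prop :=
  exists p : {poly int}, int_minpoly p theta /\ root (map_poly intr p) z.

Definition garsia (theta : R[i]) : Prop :=
  (exists p : {poly int}, int_minpoly p theta) /\
  1 < `|theta| /\ (forall z, galois_conjugate theta z -> 1 < `|z|).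

Definition complex_garsia (theta : R[i]) : Prop :=
  garsia theta /\ complex.Im theta != 0.

(* The k-th binary digit (k = 0 is the first one after the point) of x in [0,1). *)
Definition bdigit (k : nat) (x : R) : bool :=
  odd `|Num.floor (x * 2 ^+ k.+1)|%N.

(* The i.i.d. fair signs, realized on ([0,1), Lebesgue) via binary digits. *)
Definition rsign (k : nat) (x : R) : R := if bdigit k x then 1 else -1.

Definition rseries (lam : R[i]) (x : R) : R * R :=
  (limn (series (fun k => rsign k x * complex.Re (lam ^+ k))),
   limn (series (fun k => rsign k x * complex.Im (lam ^+ k)))).

Definition nu (lam : R[i]) (A : set (R * R)) : \bar R :=
  lebesgue_measure (`[0%R, 1%R[ `&` rseries lam @^-1` A).

Definition L2 := ((@lebesgue_measure R) \x (@lebesgue_measure R))%E.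

End Defs.
Arguments L2 R : clear implicits.

(* Main.v *)
(* Let theta have conjugates theta_i, so that prod |theta_i| = 2. If Q is a nonzero
   integer polynomial of degree < n with coefficients in {-1, 0, 1}, then Q(theta) <> 0:
   otherwise the minimal polynomial divides Q, and its constant term +-2 would divide
   the lowest nonzero coefficient of Q. Hence the norm prod_i Q(theta_i) is a nonzero
   integer, and bounding |Q(theta_i)| = O(|theta_i|^n) for all conjugates but theta and
   its complex conjugate yields |Q(theta)|^2 >= c (|theta|^2 / 2)^n. Consequently the
   2^n partial sums of length n of the random series are separated by a distance of
   order 2^(-n/2), so that they are the centres of disjoint squares of area of order
   2^(-n). In an open set U each such square carries mass 2^(-n), and letting n tend to
   infinity gives nu(U) <= M L2(U). Outer regularity extends this to Borel sets, and the
   Radon-Nikodym theorem concludes. *)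
Require Import Defs.
From HB Require Import structures.
From mathcomp Require Import all_boot all_order all_algebra.
From mathcomp Require Import all_classical all_reals all_analysis.
From mathcomp Require Import complex.
From mathcomp Require Import measurable_realfun zify ring lra.
Import Order.TTheory GRing.Theory Num.Theory.
Import numFieldNormedType.Exports.
Local Open Scope classical_set_scope.
Local Open Scope ring_scope.

Set Implicit Arguments.
Unset Strict Implicit.
Unset Printing Implicit Defensive.

(** * Norms and polynomials with small coefficients *)

(* Factor [q] over [K]: both sides become a double product over pairs of roots. *)
Lemma det_horner_mx_roots (K : closedFieldType) n (A : 'M[K]_n.+1)
    (rs : seq K) (q : {poly K}) :
  char_poly A = \prod_(z <- rs) ('X - z%:P) ->
  \det (horner_mx A q) = \prod_(z <- rs) q.[z].
Proof.
move=> hA.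
have srs : size rs = n.+1.
  by have := size_char_poly A; rewrite hA size_prod_XsubC => -[].
have constE (x : K) : \prod_(z <- rs) x = x ^+ n.+1.
  by rewrite big_const_seq count_predT srs; elim: n.+1 => // k /= ->; rewrite exprS.
have hlin b : \det (horner_mx A ('X - b%:P)) = \prod_(z <- rs) ('X - b%:P).[z].
  rewrite rmorphB /= horner_mx_X horner_mx_C -opprB -scaleN1r detZ.
  have -> : \det (b%:M - A) = (char_poly A).[b].
    rewrite /char_poly -horner_evalE -det_map_mx; congr (\det _).
    apply/matrixP => i j; rewrite !mxE /= horner_evalE !hornerE.
    by case: (i == j); rewrite ?mulr1n ?mulr0n ?hornerE.
  rewrite hA horner_prod -constE -big_split /=; apply: eq_bigr => z _.
  by rewrite !hornerE mulN1r opprB.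
have [s ->] := closed_field_poly_normal q.
rewrite linearZ /= detZ -constE.
under [RHS]eq_bigr do rewrite hornerZ horner_prod.
rewrite big_split /=; congr (_ * _).
rewrite exchange_big /= rmorph_prod /=.
elim: s => [|b s IHs]; first by rewrite !big_nil det1.
by rewrite !big_cons det_mulmx IHs hlin.
Qed.

(** The integer is the determinant of [q] evaluated at the companion matrix of [p], an integer
    matrix with characteristic polynomial [p]. *)
Lemma norm_int_poly (K : closedFieldType) (p q : {poly int}) (rs : seq K) :
  p \is monic -> map_poly intr p = \prod_(z <- rs) ('X - z%:P) ->
  exists N : int, N%:~R = \prod_(z <- rs) (map_poly intr q).[z].
Proof.
move=> pm prs.
have [n [A hA]] : exists n (A : 'M[int]_n), char_poly A = p.
  by exists (size p).-1, (companionmx p); exact: companionmxK.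
(* Evaluation at a matrix needs positive size; size 0 forces [p = 1], with no roots and norm 1. *)
case: n A hA => [|n] A hA.
  exists 1; case: rs prs => [|z rs]; first by rewrite !big_nil mulr1z.
  move=> /(congr1 (size : {poly K} -> nat)).
  rewrite size_prod_XsubC -hA /char_poly det_mx00.
  by rewrite rmorph1 size_poly1 => -[].
exists (\det (horner_mx A q)).
rewrite -[LHS]/(intr (\det (horner_mx A q))) -det_map_mx map_horner_mx.
by apply: det_horner_mx_roots; rewrite -map_char_poly hA.
Qed.

(** The remainder of [q] modulo the monic [p] also vanishes at [z]. Were it nonzero, its smaller
    degree would make it coprime to the irreducible [p] over the rationals, hence over [K], which
    excludes a common root. *)
Lemma common_root_dvd (K : numFieldType) (p q : {poly int}) (z : K) :
  p \is monic -> irreducible_poly (map_poly intr p : {poly rat}) ->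
  root (map_poly intr p) z -> root (map_poly intr q) z ->
  exists h, q = h * p.
Proof.
move=> pm [psz irr] pz qz.
exists (q %/ p); set r := q %% p.
have qE : q = q %/ p * p + r by exact: Pdiv.IdomainMonic.divp_eq.
suff -> : q %/ p * p = q by [].
suff r0 : r = 0 by rewrite [RHS]qE r0 addr0.
have rz : root (map_poly intr r) z.
  move: qz; rewrite {1}qE rmorphD rmorphM /= /root hornerD hornerM.
  by rewrite (rootP pz) mulr0 add0r.
apply/eqP/negPn/negP => rn0.
have injZ (F : numFieldType) : injective (intr : int -> F) by exact: intr_inj.
have sr : (size r < size p)%N.
  by rewrite ltn_modpN0 // monic_neq0.
have mapE (s : {poly int}) :
    map_poly intr s = map_poly ratr (map_poly intr s : {poly rat}) :> {poly K}.
  by apply/polyP => i; rewrite !coef_map /= ratr_int.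
have cop : coprimep (map_poly intr p : {poly rat}) (map_poly intr r).
  rewrite coprimep_def; apply/negPn/negP => /irr /(_ (dvdp_gcdl _ _)) e.
  have : (map_poly intr p : {poly rat}) %| map_poly intr r.
    by rewrite -(eqp_dvdl _ e) dvdp_gcdr.
  move/dvdp_leq; rewrite map_poly_eq0_id0; last first.
    by rewrite intr_eq0 lead_coef_eq0.
  rewrite !(size_map_inj_poly (@injZ rat)) ?rmorph0 // => /(_ rn0).
  by rewrite leqNgt sr.
have : coprimep (map_poly intr p : {poly K}) (map_poly intr r).
  by rewrite !mapE coprimep_map.
by move/coprimep_root => /(_ z pz); rewrite (rootP rz) eqxx.
Qed.

(* Compare lowest-order coefficients: each coefficient of [h] times [p`_0] has to
   be bounded by 1 in absolute value. *)
Lemma mul_small_coef_eq0 (p h : {poly int}) :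
  `|p`_0| = 2 -> (forall i, `|(h * p)`_i| <= 1) -> h = 0.
Proof.
move=> p0 hb; apply/polyP => i; rewrite coef0.
elim/ltn_ind: i => i IH.
have := hb i; rewrite coefMr big_ord_recl /= subn0 big1 ?addr0; last first.
  by move=> j _; rewrite IH ?mul0r //= /bump /= add1n; case: i j {IH} => [[]|i j] //;
     rewrite subSS ltnS leq_subr.
rewrite normrM p0.
by case: (h`_i) => [[|n]|n] //; rewrite -?mulrDl; lia.
Qed.

(** The triangle inequality leaves the geometric sum of the [|z|^i] for [i < n], which equals
    [(|z|^n - 1) / (|z| - 1)]. *)
Lemma horner_small_coef_le (C : numFieldType) (q : {poly int}) n (z : C) :
  1 < `|z| -> (size q <= n)%N -> (forall i, `|q`_i| <= 1) ->
  `|(map_poly intr q).[z]| <= `|z| ^+ n / (`|z| - 1).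
Proof.
move=> z1 sq qb; have z10 : 0 < `|z| - 1 by rewrite subr_gt0.
rewrite ler_pdivlMr //.
apply: (@le_trans _ _ ((\sum_(i < n) `|z| ^+ i) * (`|z| - 1))).
  rewrite ler_wpM2r ?(ltW z10) // (@horner_coef_wide _ n); last first.
    exact: leq_trans (size_poly _ _) sq.
  apply: le_trans (ler_norm_sum _ _ _) _; apply: ler_sum => i _.
  rewrite normrM normrX coef_map /= -intr_norm ler_piMl ?exprn_ge0 //.
  by rewrite lerz1.
by rewrite mulrC -subrX1 lerBlDr lerDl ler01.
Qed.

Lemma garsia_poly_lower_bound (C : numClosedFieldType) (p : {poly int}) (theta : C) :
  p \is monic -> irreducible_poly (map_poly intr p : {poly rat}) ->
  root (map_poly intr p) theta -> theta \isn't Num.real ->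
  (forall z : C, root (map_poly intr p) z -> 1 < `|z|) ->
  `|p`_0| = 2 ->
  exists2 c : C, 0 < c & forall n (q : {poly int}), q != 0 ->
    (size q <= n)%N -> (forall i, `|q`_i| <= 1) ->
    c * (`|theta| ^+ 2 / 2) ^+ n <= `|(map_poly intr q).[theta]| ^+ 2.
Proof.
move=> pm irr ptheta nreal pz p0.
have [rs rsE] := closed_field_poly_normal (map_poly intr p : {poly C}).
have mapm : (map_poly intr p : {poly C}) \is monic by rewrite monic_map.
rewrite (monicP mapm) scale1r in rsE.
have rsP z : z \in rs -> 1 < `|z|.
  by move=> zrs; apply: pz; rewrite rsE root_prod_XsubC.
have conj_int (q : {poly int}) :
    map_poly Num.conj (map_poly intr q) = map_poly intr q :> {poly C}.
  by apply/polyP => i; rewrite !coef_map /= rmorph_int.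
have conjq (q : {poly int}) :
    (map_poly intr q).[theta^*] = ((map_poly intr q).[theta])^* :> C.
  by rewrite -[in LHS]conj_int horner_map.
have th_rs : theta \in rs by rewrite -root_prod_XsubC -rsE.
(* As [theta] is not real, its conjugate is a different root and survives the removal of [theta]. *)
have thc_rs : theta^* \in rem theta rs.
  have : theta^* \in rs.
    by rewrite -root_prod_XsubC -rsE /root conjq (rootP ptheta) rmorph0.
  rewrite (perm_mem (perm_to_rem th_rs)) inE => /orP[/eqP e|//].
  by move: nreal; rewrite CrealE e eqxx.
pose rest := rem theta^* (rem theta rs).
have perm_rs : perm_eq rs [:: theta, theta^* & rest].
  apply: perm_trans (perm_to_rem th_rs) _; rewrite perm_cons.
  exact: perm_to_rem thc_rs.
have restP z : z \in rest -> 1 < `|z|.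
  by move=> zr; apply: rsP; rewrite (perm_mem perm_rs) !inE zr !orbT.
have split_rs (F : C -> C) :
    \prod_(z <- rs) F z = F theta * F theta^* * \prod_(z <- rest) F z.
  by rewrite (perm_big _ perm_rs) /= !big_cons mulrA.
have th0 : 0 < `|theta| by apply: lt_trans (rsP _ th_rs).
(* Evaluating the factorisation of [p] at 0 shows that the moduli of all roots multiply to 2. *)
have prod_rs : `|theta| ^+ 2 * \prod_(z <- rest) `|z| = 2.
  have := split_rs (fun z => `|z|); rewrite norm_conjC -expr2 => <-.
  have : `|(map_poly intr p : {poly C}).[0]| = 2.
    by rewrite horner_coef0 coef_map /= -intr_norm p0.
  rewrite rsE horner_prod normr_prod => <-.
  by apply: eq_bigr => z _; rewrite !hornerE normrN.
(* The constant collects the denominators of [horner_small_coef_le] over the remaining roots, so it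
   depends neither on [n] nor on [q]. *)
pose K := \prod_(z <- rest) (`|z| - 1).
have K0 : 0 < K.
  by rewrite /K big_seq; apply: prodr_gt0 => z /restP; rewrite subr_gt0.
exists K => // n q q0 sq qb.
have [N NE] := norm_int_poly q pm rsE.
have N1 : 1 <= `|N%:~R| :> C.
  rewrite -intr_norm -[1]/(1%:~R) ler_int.
  suff : N != 0 by move: (N) => -[[|?]|?] //; lia.
  (* A vanishing norm would give [p] and [q] a common root, so [q = h * p], and the small
     coefficients of [q] would force [h = 0]. *)
  apply/eqP => N0; move: NE; rewrite N0 => /esym/eqP.
  rewrite -[0%:~R]/0 prodf_seq_eq0 => /hasP[z zrs /= qz].
  have pz0 : root (map_poly intr p) z by rewrite rsE root_prod_XsubC.
  have [h hE] := common_root_dvd pm irr pz0 qz.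
  by move: q0; rewrite hE (@mul_small_coef_eq0 p h) ?mul0r ?eqxx // -hE.
move: N1; rewrite NE normr_prod (split_rs (fun z => `|_.[z]|)).
rewrite conjq norm_conjC -expr2; set Q := `|_| ^+ 2 => N1.
have Q0 : 0 <= Q by rewrite exprn_ge0.
have : 1 <= Q * \prod_(z <- rest) (`|z| ^+ n / (`|z| - 1)).
  apply: le_trans N1 _; rewrite ler_wpM2l // big_seq [leRHS]big_seq.
  by apply: ler_prod => z /restP z1; rewrite normr_ge0 horner_small_coef_le.
rewrite big_split /= prodfV prodrXl -/K.
have -> : \prod_(z <- rest) `|z| = (`|theta| ^+ 2 / 2)^-1.
  apply: (mulfI (lt0r_neq0 (exprn_gt0 2 th0))); rewrite prod_rs invf_div mulrA.
  by rewrite mulrAC divff ?mul1r // lt0r_neq0 // exprn_gt0.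
rewrite mulrA ler_pdivlMr // mul1r exprVn ler_pdivlMr //.
by rewrite exprn_gt0 // divr_gt0 ?exprn_gt0.
Qed.

(** * Separation of the partial sums *)

(** On this interval the floor of [x * 2^(j+1)] is the quotient of [k] by [2^(n-j-1)]: the first [n]
    digits of [x] are the bits of [k], read from the top. *)
Lemma bdigit_dyadic (R : realType) (n j k : nat) (x : R) : (j < n)%N ->
  k%:R / 2 ^+ n <= x < k.+1%:R / 2 ^+ n ->
  bdigit j x = odd (k %/ 2 ^ (n - j.+1)).
Proof.
move=> jn /andP[kx xk]; rewrite /bdigit.
set m := (n - j.+1)%N; set q := (k %/ 2 ^ m)%N.
have p0 i : (0 < 2 ^+ i :> R) by rewrite exprn_gt0.
have nE : 2 ^+ n = 2 ^+ j.+1 * 2 ^+ m :> R by rewrite -exprD subnKC.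
rewrite ler_pdivrMr // nE mulrA in kx; rewrite ltr_pdivlMr // nE mulrA in xk.
rewrite (_ : Num.floor _ = q%:Z) //; apply: floor_def.
rewrite intrD -[q%:~R]/(q%:R) natr1.
rewrite -(ler_pM2r (p0 m)) -(ltr_pM2r (p0 m)); apply/andP; split.
  by apply: le_trans kx; rewrite -natrX -natrM ler_nat leq_trunc_div.
apply: lt_le_trans xk _.
by rewrite -natrX -natrM ler_nat ltn_ceil // expn_gt0.
Qed.

Lemma binary_digits_inj (n k k' : nat) : (k < 2 ^ n)%N -> (k' < 2 ^ n)%N ->
  (forall i, (i < n)%N -> odd (k %/ 2 ^ i) = odd (k' %/ 2 ^ i)) -> k = k'.
Proof.
elim: n k k' => [|n IHn] k k'; first by rewrite expn0 !ltnS !leqn0 => /eqP-> /eqP->.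
rewrite expnS => kn k'n H.
have odd0 : odd k = odd k' by have := H 0 (ltn0Sn n); rewrite expn0 !divn1.
rewrite -[k]odd_double_half -[k']odd_double_half odd0; congr (_ + _.*2)%N.
apply: IHn => [||i i_n]; [lia | lia |].
by have := H i.+1 i_n; rewrite expnS !divnMA !divn2.
Qed.

(* The value of the first [n] terms of the random series on the dyadic interval
   [k/2^n, (k+1)/2^n). *)
Definition word_sum (R : realType) (lam : R[i]) (n k : nat) : R[i] :=
  \sum_(j < n) (if odd (k %/ 2 ^ (n - j.+1)) then 1 else -1) * lam ^+ j.

(** The difference [d] satisfies [theta^n * d = 2 * theta * Q(theta)] with [Q] having coefficients
    in {-1, 0, 1}. In the lower bound for [|Q(theta)|^2] the growth [|theta|^(2n)] then cancels,
    leaving [2^(-n)]. *)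
Lemma word_sum_separated (R : realType) (theta : R[i]) (p : {poly int}) :
  complex_garsia theta -> int_minpoly p theta -> `|p.[0]| = 2 ->
  exists2 c : R, 0 < c & forall n k k',
    (k < 2 ^ n)%N -> (k' < 2 ^ n)%N -> k != k' ->
    let d := word_sum theta^-1 n k - word_sum theta^-1 n k' in
    c / 2 ^+ n <= complex.Re d ^+ 2 + complex.Im d ^+ 2.
Proof.
move=> [[_ [th1 conj1]] imth] pmin p02; have [pm irr pth] := pmin.
have nreal : theta \isn't Num.real.
  by move: imth; case: (theta) => a b /=; rewrite complex_real.
have pz (z : R[i]) : root (map_poly intr p) z -> 1 < `|z|.
  by move=> rz; apply: conj1; exists p.
rewrite horner_coef0 in p02.
have [c c0 hc] := garsia_poly_lower_bound pm irr pth nreal pz p02.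
have th0 : 0 < `|theta| by exact: lt_trans th1.
have thn0 : theta != 0 by rewrite -normr_gt0.
(* The factor [4 * |theta|^2] is the squared modulus of the [2 * theta] in [dE]. *)
pose c' := 4 * `|theta| ^+ 2 * c.
have c'0 : 0 < c' by rewrite /c' !mulr_gt0 // exprn_gt0.
have c'E : (complex.Re c')%:C%C = c' by rewrite RRe_real // gtr0_real.
exists (complex.Re c'); first by rewrite -ltcR c'E.
move=> n k k' kn k'n kk' /=.
set d := word_sum _ _ _ - _.
pose e i : int := (odd (k %/ 2 ^ i))%:Z - (odd (k' %/ 2 ^ i))%:Z.
pose q := \poly_(i < n) e i.
have qn0 : q != 0.
  apply: contra_neq kk' => q0; apply: (binary_digits_inj kn k'n) => i i_n.
  have := congr1 (fun s : {poly int} => s`_i) q0.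
  by rewrite coef_poly i_n coef0 /e; do 2 case: odd.
have qb i : `|q`_i| <= 1.
  by rewrite coef_poly; case: ifP => // _; rewrite /e; do 2 case: odd.
have dE : theta ^+ n * d = 2 * theta * (map_poly intr q).[theta].
  rewrite /d /word_sum -sumrB (@horner_coef_wide _ n); last first.
    by rewrite (leq_trans (size_poly _ _)) // size_poly.
  (* The bit of weight [2^i] carries the exponent [n - i - 1] of [theta^-1], so the sum is read
     backwards to become a polynomial in [theta]. *)
  rewrite !mulr_sumr (reindex_inj rev_ord_inj) /=; apply: eq_bigr => i _.
  have -> : (n - (n - i.+1).+1 = i)%N by have := ltn_ord i; lia.
  have -> : theta ^+ n = theta ^+ i.+1 * theta ^+ (n - i.+1).
    by rewrite -exprD subnKC.
  rewrite -mulrBl mulrCA exprVn mulfK ?expf_neq0 // coef_map coef_poly ltn_ord /=.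
  by rewrite /e exprS; do 2 case: odd; rewrite /= ?subrr /=; ring.
have dn : (`|theta| ^+ 2) ^+ n * `|d| ^+ 2 =
    4 * `|theta| ^+ 2 * `|(map_poly intr q).[theta]| ^+ 2.
  have h := congr1 (fun z => `|z| ^+ 2) dE.
  by rewrite !normrM !exprMn normrX exprAC normr_nat -natrX in h.
have := hc n q qn0 (size_poly _ _) qb; rewrite expr_div_n => hcn.
rewrite -lecR add_Re2_Im2 rmorphM /= c'E fmorphV rmorphXn /= rmorph_nat.
rewrite -(ler_pM2l (exprn_gt0 n (exprn_gt0 2 th0))) dn /c'.
have -> : (`|theta| ^+ 2) ^+ n * (4 * `|theta| ^+ 2 * c / 2 ^+ n) =
   4 * `|theta| ^+ 2 * (c * ((`|theta| ^+ 2) ^+ n / 2 ^+ n)) by ring.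
by rewrite ler_pM2l // mulr_gt0 // exprn_gt0.
Qed.

(** * Measure theory on the plane *)

Section OuterRegularity.
Context (R : realType) (m : {finite_measure set (R * R)%type -> \bar R}).

(* Enclosing [A] and its complement symmetrically in open sets makes stability
   under complement immediate. *)
Definition regular_set (A : set (R * R)) := forall e : R, 0 < e ->
  exists U V : set (R * R), [/\ open U /\ measurable U, open V /\ measurable V,
    A `<=` U, ~` A `<=` V & (m (U `&` V) < e%:E)%E].

Lemma regular_setC A : regular_set A -> regular_set (~` A).
Proof.
move=> rA e /rA[U [V [oU oV AU AV mUV]]]; exists V, U; split => //.
  by rewrite setCK.
by rewrite setIC.
Qed.

(** The union of the [U i] is open, but the complement can only be enclosed in a finite intersection
    of the [V i]. The error from stopping at [n] lies in the tail [F n], which is small by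
    continuity from above. *)
Lemma regular_bigcup (A : (set (R * R))^nat) :
  (forall i, regular_set (A i)) -> regular_set (\bigcup_i A i).
Proof.
move=> rA e e0.
have ei0 i : 0 < (e / 2) / (2 ^ i.+1)%:R :> R by rewrite !divr_gt0.
have /choice[U hU] i : exists U V : set (R * R),
  [/\ open U /\ measurable U, open V /\ measurable V,
    A i `<=` U, ~` (A i) `<=` V &
    (m (U `&` V) < ((e / 2) / (2 ^ i.+1)%:R)%:E)%E] by exact: rA.
have {hU}/choice[V hUV] := hU.
have oU i : open (U i) by have [[]] := hUV i.
have mU i : measurable (U i) by have [[]] := hUV i.
have oV i : open (V i) by have [_ []] := hUV i.
have mV i : measurable (V i) by have [_ []] := hUV i.
pose F n := \bigcup_i U i `\` \big[setU/set0]_(i < n) U i.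
have mbU : measurable (\bigcup_i U i) by exact: bigcup_measurable.
have mF n : measurable (F n).
  by apply: measurableD => //; exact: bigsetU_measurable.
have capF : \bigcap_n F n = set0.
  rewrite -subset0 => x Fx; have [[i _ Uix] _] := Fx 0 I.
  by have [_] := Fx i.+1 I; apply; rewrite -bigcup_mkord; exists i => //=.
have : (m \o F) n @[n --> \oo] --> m (\bigcap_n F n).
  apply: nonincreasing_cvg_mu => //.
  - by rewrite ltey_eq fin_num_measure.
  - by rewrite capF.
  - move=> i j ij; apply/subsetPset => x [Ux nUx]; split=> // Ux'; apply: nUx.
    move: Ux'; rewrite -!bigcup_mkord => -[k /= ki Uk].
    by exists k => //=; exact: leq_trans ij.
rewrite capF measure0.
move=> /fine_cvgP[_ /cvgrPdist_lt /(_ _ (divr_gt0 e0 (ltr0Sn R 1)))].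
case=> n _ /(_ n (leqnn n)) /=; rewrite sub0r normrN ger0_norm ?fine_ge0 // => Fn.
have {}Fn : (m (F n) < (e / 2)%:E)%E.
  by rewrite -[m _]fineK ?fin_num_measure // lte_fin.
exists (\bigcup_i U i), (\big[setI/setT]_(i < n) V i); split.
- by split=> //; apply: bigcup_open => i _.
- split; first by elim/big_ind: _ => // *; [exact: openT | exact: openI].
  by apply: bigsetI_measurable.
- by move=> x [i _ Aix]; exists i => //; have [_ _ + _ _] := hUV i; apply.
- move=> x nAx; rewrite -bigcap_mkord => i _.
  by have [_ _ _ + _] := hUV i; apply => Aix; apply: nAx; exists i.
have mUV i : measurable (U i `&` V i) by exact: measurableI.
have mB : measurable (\big[setU/set0]_(i < n) (U i `&` V i)).
  exact: bigsetU_measurable.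
(* A point of the overlap is either in no [U i] with [i < n], hence in [F n], or in some [U i] and
   then also in [V i]. The tail costs [e / 2], and the other terms a geometric sum below [e / 2]. *)
apply: (@le_lt_trans _ _ (m (F n `|` \big[setU/set0]_(i < n) (U i `&` V i)))).
  apply: le_measure; rewrite ?inE; [| exact: measurableU |].
    by apply: measurableI => //; exact: bigsetI_measurable.
  move=> x [Ux Vx].
  have [UVx|nUVx] := pselect ((\big[setU/set0]_(i < n) (U i `&` V i)) x); first by right.
  left; split => // Unx; apply: nUVx.
  move: Unx Vx; rewrite -(bigcup_mkord n U) -(bigcap_mkord n V).
  rewrite -(bigcup_mkord n (fun i => U i `&` V i)) => -[i /= i_n Uix].
  by move=> /(_ i i_n) Vix; exists i.
apply: (@le_lt_trans _ _ (m (F n) + \sum_(i < n) m (U i `&` V i))%E).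
  rewrite (le_trans (measureU2 _ _ _)) // leeD2l //.
  by apply: (@Boole_inequality _ _ _ m (fun i => U i `&` V i)).
rewrite [e](splitr e) EFinD; apply: lte_leD => //.
  by apply/sum_fin_numP => i _ _; exact: fin_num_measure.
apply: (@le_trans _ _ (\sum_(i < n) ((e / 2) / (2 ^ i.+1)%:R)%:E)%E).
  by apply: lee_sum => i _; have [_ _ _ _ /ltW] := hUV i.
rewrite sumEFin lee_fin.
have -> : forall n, \sum_(i < n) (e / 2) / (2 ^ i.+1)%:R = (e / 2) * (1 - 1 / 2 ^+ n) :> R.
  elim=> [|k IHk]; first by rewrite big_ord0 expr0 divr1 subrr mulr0.
  rewrite big_ord_recr /= IHk natrX exprS.
  have : 2 ^+ k != 0 :> R by rewrite expf_neq0.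
  by move=> ?; field.
by rewrite ger_pMr ?divr_gt0 // gerBl divr_ge0 // exprn_ge0.
Qed.

Lemma regular_sigma_algebra : sigma_algebra setT regular_set.
Proof.
have r0 : regular_set set0.
  move=> e e0; exists set0, setT; split=> //.
  - by split; [exact: open0|].
  - by split; [exact: openT|].
  - by rewrite set0I measure0.
split => //; first by move=> A /regular_setC; rewrite setTD.
exact: regular_bigcup.
Qed.

(** The sets [B] with regular preimage form a sigma-algebra, so the rays []x, +oo[] suffice. *)
Lemma regular_preimage (f : R * R -> R) (B : set R) :
  continuous f -> measurable_fun setT f ->
  measurable B -> regular_set (f @^-1` B).
Proof.
move=> cf mf mB.
have : (@measurable_realfun.RGenOInfty.G R).-sigma.-measurable B.
  by rewrite -measurable_realfun.RGenOInfty.measurableE.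
move=> H; apply: (H [set B | regular_set (f @^-1` B)]); split.
- have [r0 rC rU] := regular_sigma_algebra; split => /=.
  + by rewrite preimage_set0.
  + by move=> A rA; rewrite setTD preimage_setC; exact: regular_setC.
  + by move=> A rA; rewrite preimage_bigcup; exact: rU.
- move=> _ [x ->] /= e e0.
  have mray (C : set R) : measurable C -> measurable (f @^-1` C).
    by move=> mC; rewrite -[X in measurable X]setTI; exact: mf.
  (* The preimage of the open ray is its own enclosure; that of the complementary closed ray is
     enclosed by slightly longer open rays, whose overlaps [F n] with the former decrease to the
     empty set. *)
  pose V n := f @^-1` `]-oo, (x + n.+1%:R^-1)[%classic.
  pose F n := f @^-1` `]x, +oo[%classic `&` V n.
  have mF n : measurable (F n) by apply: measurableI; exact: mray.
  have capF : \bigcap_n F n = set0.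
    rewrite -subset0 => z Fz; have [+ _] := Fz 0 I.
    rewrite /= in_itv /= andbT => xz.
    have fzx : 0 < f z - x by rewrite subr_gt0.
    have [n _ /(_ n (leqnn n)) /= hn] := near_infty_natSinv_lt (PosNum fzx).
    have [_] := Fz n I; rewrite /V /= in_itv /= => fzn.
    by move: fzn; rewrite -ltrBlDl ltNge (ltW hn).
  have : (m \o F) n @[n --> \oo] --> m (\bigcap_n F n).
    apply: nonincreasing_cvg_mu => //.
    - by rewrite ltey_eq fin_num_measure.
    - by rewrite capF.
    - move=> i j ij; apply/subsetPset => z [zx]; rewrite /V /= in_itv /= => zj.
      split=> //; rewrite /V /= in_itv /=; apply: lt_le_trans zj _.
      by rewrite lerD2l lef_pV2 ?posrE // ler_nat ltnS.
  rewrite capF measure0 => /fine_cvgP[_ /cvgrPdist_lt /(_ _ e0)].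
  case=> n _ /(_ n (leqnn n)) /=; rewrite sub0r normrN ger0_norm ?fine_ge0 // => Fn.
  exists (f @^-1` `]x, +oo[%classic), (V n); split => //.
  + by split; [apply: open_comp => // z _; exact: cf|exact: mray].
  + by split; [apply: open_comp => // z _; exact: cf|exact: mray].
  + move=> z /=; rewrite /V /= !in_itv /= andbT => /negP; rewrite -leNgt => zx.
    by apply: le_lt_trans zx _; rewrite ltrDl invr_gt0.
  + by rewrite -/(F n) -[m (F n)]fineK ?fin_num_measure // lte_fin.
Qed.

(** The product sigma-algebra is generated by preimages under the two projections, which are
    regular. *)
Lemma finite_measure_outer_regular (A : set (R * R)) (e : R) :
  measurable A -> 0 < e ->
  exists U : set (R * R), [/\ open U, measurable U, A `<=` U & (m (U `\` A) < e%:E)%E].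
Proof.
move=> mA e0.
have rA : regular_set A.
  apply: (mA regular_set); split; first exact: regular_sigma_algebra.
  move=> _ [|] [B mB <-]; rewrite setTI; apply: regular_preimage => //.
  - by move=> z; exact: cvg_fst.
  - by move=> z; exact: cvg_snd.
have [U [V [[oU mU] [oV mV] AU AV mUV]]] := rA _ e0.
exists U; split=> //; apply: le_lt_trans mUV.
apply: le_measure; rewrite ?inE; [exact: measurableD|exact: measurableI|].
by move=> x [Ux nAx]; split=> //; exact: AV.
Qed.

End OuterRegularity.

(* Truncating the Radon-Nikodym derivative [g] at [M] changes no integral: on
   [A `&` [set x | M < g x]] both integrals are squeezed between [nu] and [M * mu]. *)
Lemma bounded_density (d : measure_display) (T : measurableType d) (R : realType)
    (mu : {sigma_finite_measure set T -> \bar R})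
    (nu : {finite_measure set T -> \bar R}) (M : R) : 0 <= M ->
  (forall A, measurable A -> nu A <= M%:E * mu A)%E ->
  exists f : T -> R, [/\ measurable_fun setT f, forall z, 0 <= f z <= M &
    forall A, measurable A -> nu A = (\int[mu]_(z in A) (f z)%:E)%E].
Proof.
move=> M0 numu.
have dom : nu `<< mu.
  apply/null_content_dominatesP => A mA muA0; apply/eqP.
  by rewrite -measure_le0 (le_trans (numu _ mA)) // muA0 mule0.
have [g [g0 gfin gint gE]] := radon_nikodym_sigma_finite dom.
have mg : measurable_fun setT g by case/integrableP: gint.
have mfg : measurable_fun setT (fine \o g) by exact: measurableT_comp.
pose f z := Num.min (fine (g z)) M.
have mf : measurable_fun setT f.
  by apply: measurable_minr => //; exact: measurable_cst.
have fg z : ((f z)%:E <= g z)%E.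
  by rewrite -[leRHS]fineK // lee_fin ge_min lexx.
exists f; split => //.
  by move=> z; rewrite ge_min lexx orbT andbT le_min M0 fine_ge0.
have f0 z : (0 <= (f z)%:E)%E by rewrite lee_fin le_min M0 fine_ge0.
have mfE : measurable_fun setT (EFin \o f) by exact/measurable_EFinP.
pose B := [set z | M < fine (g z)].
have mB : measurable B.
  have mlt : measurable_fun setT (fun z => M < fine (g z)).
    by apply: measurable_fun_ltr => //; exact: measurable_cst.
  by have := mlt measurableT [set true] I; rewrite setTI.
move=> A mA.
have mAB : measurable (A `&` B) by exact: measurableI.
have mAD : measurable (A `\` B) by exact: measurableD.
have AE : A = (A `&` B) `|` (A `\` B) by rewrite setUIDK.
have disj : [disjoint (A `&` B) & (A `\` B)]%classic.
  by apply/disj_setPS => z [[_ Bz] [_ nBz]].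
rewrite gE // [in LHS]AE [in RHS]AE.
rewrite !ge0_integral_setU //; try exact: measurable_funTS.
congr (_ + _)%E; last first.
  apply: eq_integral => z; rewrite inE => -[_ /negP]; rewrite -leNgt => gM.
  by rewrite -[LHS]fineK // /f; congr EFin; apply/esym/min_idPl.
apply/eqP; rewrite eq_le; apply/andP; split.
  rewrite -(gE _ mAB); apply: le_trans (numu _ mAB) _.
  rewrite -(integral_cst mu mAB M%:E); apply: ge0_le_integral => //.
  - exact: measurable_funTS.
  - move=> z [_ Bz]; rewrite lee_fin /f le_min lexx andbT.
    exact: ltW.
by apply: ge0_le_integral => //; exact: measurable_funTS.
Qed.

(* The product of two copies of [lebesgue_measure] lives on the generated
   sigma-algebra type; this transports its structure to [R * R]. *)
Section PlaneLebesgueMeasure.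
Context (R : realType).
Let leb2 := ((@lebesgue_measure R) \x (@lebesgue_measure R))%E.
Let L : set (R * R)%type -> \bar R := L2 R.

Let L0 : L set0 = 0%E. Proof. exact: (measure0 leb2). Qed.
Let L_ge0 A : (0 <= L A)%E. Proof. exact: (measure_ge0 leb2). Qed.
Let L_sigma_additive : semi_sigma_additive L.
Proof. exact: (@measure_semi_sigma_additive _ _ _ leb2). Qed.

HB.instance Definition _ := isMeasure.Build _ _ _ L L0 L_ge0 L_sigma_additive.

Lemma L2_ball (z : R * R) (r : R) : 0 <= r -> L2 R (ball z r) = ((r *+ 2) ^+ 2)%:E.
Proof.
move=> r0; have -> : ball z r = ball z.1 r `*` ball z.2 r by [].
transitivity (lebesgue_measure (ball z.1 r) * lebesgue_measure (ball z.2 r))%E.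
  by apply: product_measure1E; exact: measurable_ball.
by rewrite !lebesgue_measure_ball // -EFinM expr2.
Qed.

Lemma measurable_ball_prod (z : R * R) (r : R) : measurable (ball z r).
Proof. exact: (measurableX (measurable_ball z.1 r) (measurable_ball z.2 r)). Qed.

Lemma bigcup_ball_prod : \bigcup_k ball ((0, 0) : R * R) k%:R = setT.
Proof.
apply/seteqP; split=> // z _.
exists (Num.trunc (`|z.1| + `|z.2|)).+1 => //.
have /andP[_ h] := truncn_itv (addr_ge0 (normr_ge0 z.1) (normr_ge0 z.2)).
by split; rewrite /= /ball /= sub0r normrN; apply: le_lt_trans h;
  rewrite ?lerDl ?lerDr.
Qed.

Let L_sigma_finite : sigma_finite setT L.
Proof.
exists (fun k => ball ((0, 0) : R * R) k%:R); first by rewrite bigcup_ball_prod.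
move=> k; split; first exact: measurable_ball_prod.
by rewrite /L L2_ball // ltry.
Qed.

HB.instance Definition _ := Measure_isSigmaFinite.Build _ _ _ L L_sigma_finite.

Definition plane_lebesgue_measure :
  {sigma_finite_measure set (R * R)%type -> \bar R} := L.
End PlaneLebesgueMeasure.

(** The two integrals live on different measurable-space structures over the same set; pushing
    forward along the identity matches them. *)
Lemma integral_L2E (R : realType) (A : set (R * R)) (f : R * R -> R) :
  measurable A -> measurable_fun setT f -> (forall z, 0 <= f z) ->
  (\int[L2 R]_(z in A) (f z)%:E = \int[plane_lebesgue_measure R]_(z in A) (f z)%:E)%E.
Proof.
move=> mA mf f0.
pose phi : (measurableTypeR R * measurableTypeR R)%type -> (R * R)%type := id.
have mphi : measurable_fun setT phi by move=> _ B mB; rewrite setTI.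
have mfA : measurable_fun A (EFin \o f).
  by apply: measurable_funTS; exact/measurable_EFinP.
apply/esym.
apply: (@ge0_integral_pushforward _ _ _ _ R phi mphi
  ((@lebesgue_measure R) \x (@lebesgue_measure R))%E A (EFin \o f) mA mfA).
by move=> z _; rewrite lee_fin.
Qed.

(** * The random series *)

Section RandomSeries.
Context (R : realType).

Lemma measurable_bdigit (k : nat) : measurable_fun setT (@bdigit R k).
Proof.
apply: (measurable_fun_bool true); rewrite setTI.
have mI (z : int) : measurable [set x : R | Num.floor (x * 2 ^+ k.+1) = z].
  have mM : measurable_fun setT (fun x : R => x * 2 ^+ k.+1).
    by apply: measurable_funM; [exact: measurable_id | exact: measurable_cst].
  rewrite (_ : mkset _ = (fun x : R => x * 2 ^+ k.+1) @^-1`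
      `[z%:~R, (z + 1)%:~R[%classic).
    by rewrite -[X in measurable X]setTI; exact: mM.
  apply/seteqP; split => x /=; rewrite in_itv /=; last exact: floor_def.
  by move=> <-; exact: floor_itv.
(* The digit is the parity of the absolute value of the floor, so each odd [i] accounts for the
   floors [i] and [-i]. *)
rewrite (_ : _ @^-1` _ = \bigcup_(i in [set i | odd i])
   ([set x : R | Num.floor (x * 2 ^+ k.+1) = i%:Z] `|`
    [set x : R | Num.floor (x * 2 ^+ k.+1) = - i%:Z])).
  by apply: bigcup_measurable => i _; apply: measurableU; exact: mI.
apply/seteqP; split => x /=.
  rewrite /bdigit => hodd; exists `|Num.floor (x * 2 ^+ k.+1)|%N => //=.
  by case: (intP (Num.floor (x * 2 ^+ k.+1))) => [|n|n];
    [left | left | right]; lia.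
by rewrite /bdigit => -[i /= oi [|] ->]; rewrite ?abszN.
Qed.

Lemma measurable_rsign (k : nat) : measurable_fun setT (@rsign R k).
Proof.
apply: measurable_fun_ifT; [exact: measurable_bdigit | |];
exact: measurable_cst.
Qed.

Lemma normr_rsign (k : nat) (x : R) : `|rsign k x| = 1.
Proof. by rewrite /rsign; case: ifP; rewrite ?normrN normr1. Qed.

(** Convergence is absolute, by comparison with the geometric series of ratio [a], hence holds at
    every [x] and not just almost everywhere. *)
Lemma is_cvg_rsign_series (u : R^nat) (a : R) (x : R) :
  0 <= a < 1 -> (forall k, `|u k| <= a ^+ k) ->
  cvgn (series (fun k => rsign k x * u k)).
Proof.
move=> /andP[a0 a1] ua; apply: normed_cvg.
apply: (@series_le_cvg _ _ (geometric 1 a)) => [n|n|n|].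
- exact: normr_ge0.
- by rewrite /geometric /= mul1r exprn_ge0.
- by rewrite /geometric /= normrM normr_rsign !mul1r.
- by apply: is_cvg_geometric_series; rewrite ger0_norm.
Qed.

Lemma measurable_rsign_series (u : R^nat) (a : R) :
  0 <= a < 1 -> (forall k, `|u k| <= a ^+ k) ->
  measurable_fun setT (fun x : R => limn (series (fun k => rsign k x * u k))).
Proof.
move=> a01 ua.
apply: (@measurable_fun_cvg _ _ _ _ (fun n x => series (fun k => rsign k x * u k) n)).
  move=> n; rewrite /series /=; apply: measurable_sum => i.
  by apply: measurable_funM; [exact: measurable_rsign | exact: measurable_cst].
by move=> x _; exact: is_cvg_rsign_series ua.
Qed.

Context (lam : R[i]) (lam1 : `|lam| < 1).

Lemma Re_norm_lam : 0 <= complex.Re `|lam| < 1.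
Proof.
have e : (complex.Re `|lam|)%:C%C = `|lam| by rewrite RRe_real // normr_real.
by apply/andP; split; [rewrite -ler0c e | rewrite -ltcR e].
Qed.

Lemma normr_Re_exp k : `|complex.Re (lam ^+ k)| <= complex.Re `|lam| ^+ k.
Proof.
have e : (complex.Re `|lam|)%:C%C = `|lam| by rewrite RRe_real // normr_real.
rewrite -lecR; apply: le_trans (normc_ge_Re _) _.
by rewrite rmorphXn /= e normrX.
Qed.

Lemma normr_Im_exp k : `|complex.Im (lam ^+ k)| <= complex.Re `|lam| ^+ k.
Proof.
have e : (complex.Re `|lam|)%:C%C = `|lam| by rewrite RRe_real // normr_real.
(* Since [-Im z] is the real part of ['i * z], the bound for real parts applies. *)
rewrite -[complex.Im _]opprK normrN -ReiNIm -lecR.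
apply: le_trans (normc_ge_Re _) _; rewrite rmorphXn /= e normrM normrX.
suff -> : `|'i%C| = 1 :> R[i] by rewrite mulr1.
by rewrite normc_def /= expr0n /= expr1n add0r sqrtr1.
Qed.

Lemma measurable_rseries : measurable_fun setT (rseries lam).
Proof.
apply: measurable_fun_pair.
- exact: measurable_rsign_series Re_norm_lam normr_Re_exp.
- exact: measurable_rsign_series Re_norm_lam normr_Im_exp.
Qed.

Definition partial_rseries (n : nat) (x : R) : R * R :=
  (series (fun k => rsign k x * complex.Re (lam ^+ k)) n,
   series (fun k => rsign k x * complex.Im (lam ^+ k)) n).

Lemma cvg_partial_rseries (x : R) :
  partial_rseries n x @[n --> \oo] --> rseries lam x.
Proof.
have cRe := @is_cvg_rsign_series _ _ x Re_norm_lam normr_Re_exp.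
have cIm := @is_cvg_rsign_series _ _ x Re_norm_lam normr_Im_exp.
exact: (cvg_pair cRe cIm).
Qed.

Lemma partial_rseries_dyadic (n k : nat) (x : R) :
  k%:R / 2 ^+ n <= x < k.+1%:R / 2 ^+ n ->
  partial_rseries n x =
  (complex.Re (word_sum lam n k), complex.Im (word_sum lam n k)).
Proof.
move=> xk; rewrite /partial_rseries /series /= !big_mkord /word_sum.
rewrite (big_morph (@complex.Re R) (id1 := 0) (op1 := +%R)) //; last by do 2 case=> ? ?.
rewrite (big_morph (@complex.Im R) (id1 := 0) (op1 := +%R)) //; last by do 2 case=> ? ?.
congr pair; apply: eq_bigr => j _; rewrite /rsign (bdigit_dyadic _ xk) //.
- by case: odd; case: (lam ^+ j) => u v /=; rewrite ?mulN1r ?mul1r //=; ring.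
- by case: odd; case: (lam ^+ j) => u v /=; rewrite ?mulN1r ?mul1r //=; ring.
Qed.

(** * The law of the series as a finite measure *)

Section NuMeasure.

Let nu0 : nu lam set0 = 0%E.
Proof. by rewrite /nu preimage_set0 setI0 measure0. Qed.

Let nu_ge0 A : (0 <= nu lam A)%E. Proof. exact: measure_ge0. Qed.

Let mpre A : measurable A -> measurable (`[0%R, 1%R[ `&` rseries lam @^-1` A).
Proof.
move=> mA; apply: measurableI => //.
by rewrite -[X in measurable X]setTI; exact: measurable_rseries.
Qed.

Let nu_sigma_additive : semi_sigma_additive (nu lam).
Proof.
move=> F mF tF mUF; rewrite /nu preimage_bigcup setI_bigcupr.
apply: measure_semi_sigma_additive => [n||].
- exact: mpre.
- apply/trivIsetP => i j _ _ ij; rewrite setIACA -(preimage_setI (rseries lam)).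
  by move/trivIsetP : tF => /(_ _ _ _ _ ij) -> //; rewrite preimage_set0 setI0.
- by rewrite -setI_bigcupr -preimage_bigcup; exact: mpre.
Qed.

HB.instance Definition _ := isMeasure.Build _ _ _ (nu lam)
  nu0 nu_ge0 nu_sigma_additive.

Let nu_fin : fin_num_fun (nu lam).
Proof.
move=> A mA; rewrite ge0_fin_numE //.
apply: (@le_lt_trans _ _ (lebesgue_measure (`[0%R, 1%R[%classic : set R))).
  by apply: le_measure; rewrite ?inE //; exact: mpre.
by rewrite lebesgue_measure_itv /= lte01 oppr0 addr0 ltry.
Qed.

HB.instance Definition _ := Measure_isFinite.Build _ _ _ (nu lam) nu_fin.

Definition nu_measure : {finite_measure set (R * R)%type -> \bar R} := nu lam.

End NuMeasure.

End RandomSeries.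

(** * Domination by planar Lebesgue measure *)

Section Separated.
Context (R : realType) (lam : R[i]) (lam1 : `|lam| < 1) (c : R) (c0 : 0 < c).
Hypothesis sep : forall n k k', (k < 2 ^ n)%N -> (k' < 2 ^ n)%N -> k != k' ->
  let d := word_sum lam n k - word_sum lam n k' in
  c / 2 ^+ n <= complex.Re d ^+ 2 + complex.Im d ^+ 2.

Let pt n k : R * R := (complex.Re (word_sum lam n k), complex.Im (word_sum lam n k)).
(* Chosen so that squares of half-side [rad n] around the points [pt n k] are
   disjoint, with area c / 2^(n+1). *)
Let rad n : R := Num.sqrt (c / 2 ^+ n.+1) / 2.
Let L := plane_lebesgue_measure R.

Let p2 n : 0 < 2 ^+ n :> R. Proof. exact: exprn_gt0. Qed.

Let rad_gt0 n : 0 < rad n.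
Proof. by rewrite divr_gt0 // sqrtr_gt0 divr_gt0. Qed.

Let rad_sqr n : (2 * rad n) ^+ 2 = c / 2 ^+ n.+1.
Proof. by rewrite mulrC divfK // sqr_sqrtr // divr_ge0 // ltW. Qed.

Let L_ball z n : L (ball z (rad n)) = (c / 2 ^+ n.+1)%:E.
Proof.
rewrite [LHS]L2_ball ?ltW // -rad_sqr mulr2n; congr EFin; ring.
Qed.

(** Balls are squares here: a common point puts both coordinate differences below [2 * rad n], so
    the squared distance is below [2 * c / 2^(n+1)], against [sep]. *)
Let ball_disjoint n k k' : (k < 2 ^ n)%N -> (k' < 2 ^ n)%N -> k != k' ->
  ball (pt n k) (rad n) `&` ball (pt n k') (rad n) = set0.
Proof.
move=> kn k'n kk'; rewrite -subset0 => z [[/= z1 z2] [/= z3 z4]].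
have := sep kn k'n kk' => /=.
have r0 := rad_gt0 n.
have sq (a b t : R) : `|a - t| < rad n -> `|b - t| < rad n ->
    (a - b) ^+ 2 < (2 * rad n) ^+ 2.
  move=> at_ bt; have abt : `|a - b| < 2 * rad n.
    have -> : a - b = (a - t) - (b - t) by ring.
    by rewrite (le_lt_trans (ler_normB _ _)) //; lra.
  by rewrite -[X in X < _]real_normK ?num_real // ltrXn2r.
have := sq _ _ _ z1 z3; have := sq _ _ _ z2 z4.
rewrite rad_sqr [2 ^+ n.+1]exprS invfM.
set W := word_sum lam n k; set W' := word_sum lam n k'.
have -> : complex.Re (W - W') = complex.Re W - complex.Re W'.
  by case: W => ? ?; case: W' => ? ?.
have -> : complex.Im (W - W') = complex.Im W - complex.Im W'.
  by case: W => ? ?; case: W' => ? ?.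
have : 0 < c / 2 ^+ n by rewrite divr_gt0.
lra.
Qed.

Let near_rad (e : R) : 0 < e -> \forall n \near \oo, rad n < e.
Proof.
move=> e0.
have half : `|2^-1 : R| < 1 by rewrite ger0_norm // invf_lt1 // ltr1n.
have /cvgrPdist_lt/(_ _ (exprn_gt0 2 e0)) := cvg_geometric c half.
apply: filterS => n; rewrite sub0r normrN /geometric /= => hn.
rewrite -(ltr_pXn2r (_ : 0 < 2)%N) ?nnegrE ?ltW //.
apply: le_lt_trans (le_lt_trans (ler_norm _) hn).
have := rad_sqr n; rewrite exprMn [2 ^+ n.+1]exprS invfM exprVn.
have := divr_gt0 c0 (p2 n); lra.
Qed.

Lemma nu_open_le (U : set (R * R)) : open U -> measurable U ->
  (nu lam U <= (2 / c)%:E * L2 R U)%E.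
Proof.
move=> oU mU; rewrite -[L2 R U]/(L U).
(* At level [n], [G n] consists of the squares contained in [U], and [E n] is the union of the
   dyadic intervals [F n] of the corresponding sign words. *)
pose good n k := (k < 2 ^ n)%N && `[< ball (pt n k) (rad n) `<=` U >].
pose I n k : set R := `[k%:R / 2 ^+ n, k.+1%:R / 2 ^+ n[%classic.
pose F n k := if good n k then I n k else set0.
pose G n k := if good n k then ball (pt n k) (rad n) else set0.
pose E n := \big[setU/set0]_(k < 2 ^ n) F n k.
have mF n k : measurable (F n k).
  by rewrite /F; case: ifP => // _; exact: measurable_itv.
have mG n k : measurable (G n k).
  by rewrite /G; case: ifP => // _; exact: measurable_ball_prod.
have mE n : measurable (E n) by exact: bigsetU_measurable.
have leE n : (lebesgue_measure (E n) <= (2 / c)%:E * L U)%E.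
  apply: (@le_trans _ _ (\sum_(k < 2 ^ n) lebesgue_measure (F n k))%E).
    by apply: (Boole_inequality (@lebesgue_measure R)) => i _; exact: mF.
  (* The length [2^(-n)] of the interval is [2 / c] times the area [c / 2^(n+1)] of its square. *)
  have FG k : (lebesgue_measure (F n k) = (2 / c)%:E * L (G n k))%E.
    rewrite /F /G; case: ifP => _; last by rewrite !measure0 mule0.
    rewrite L_ball lebesgue_measure_itv /= lte_fin ltr_pM2r ?invr_gt0 //.
    rewrite ltr_nat ltnSn -EFinB -EFinM; congr EFin.
    rewrite -mulrBl -natr1 exprS.
    have := p2 n; have := c0; move=> cp np; field.
    by rewrite !gt_eqF.
  under eq_bigr do rewrite FG.
  rewrite -ge0_sume_distrr // lee_pmul2l //; last by rewrite lte_fin divr_gt0.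
  have tG : trivIset setT (G n).
    apply/trivIsetP => i j _ _ ij; rewrite /G.
    case: ifP => [/andP[gi _]|]; last by rewrite set0I.
    case: ifP => [/andP[gj _]|]; last by rewrite setI0.
    exact: ball_disjoint.
  rewrite -[leLHS](@measure_bigsetU _ _ _ L (G n)) //.
  apply: le_measure; rewrite ?inE //.
    by apply: bigsetU_measurable => k _; exact: mG.
  rewrite -bigcup_mkord => z [k _]; rewrite /G; case: ifP => // /andP[_ /asboolP].
  exact.
(* The union of the [H N] is the lower limit of the [E n]; each [H N] inherits the bound [leE]. *)
pose H N := \bigcap_(n in [set n | (N <= n)%N]) E n.
have mH N : measurable (H N).
  by apply: bigcap_measurable => [|n _]; [exists N => /= | exact: mE].
have mUH : measurable (\bigcup_N H N) by exact: bigcup_measurable.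
have mpre : measurable (`[0%R, 1%R[ `&` rseries lam @^-1` U).
  apply: measurableI => //.
  by rewrite -[X in measurable X]setTI; exact: measurable_rseries.
(* Once the partial sum is within [e / 2] of the limit and [rad n < e / 2], the whole square around
   the partial sum lies in the [e]-ball inside [U], so [x] belongs to [E n]. *)
have sub : `[0%R, 1%R[ `&` rseries lam @^-1` U `<=` \bigcup_N H N.
  move=> x [x01 /= Ux].
  have /nbhs_ballP[e /= e0 eU] : nbhs (rseries lam x) U.
    by apply: open_nbhs_nbhs; split.
  have e20 : 0 < e / 2 by rewrite divr_gt0.
  have near1 : \forall n \near \oo, ball (rseries lam x) (e / 2) (partial_rseries lam n x).
    apply: (cvg_partial_rseries lam1); exact: nbhsx_ballx.
  have [N _ hN] := filterI near1 (near_rad e20).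
  exists N => // n /= Nn; have [h1 h2] := hN _ Nn.
  move: x01; rewrite /= in_itv /= => /andP[x0 x1].
  have x2n : 0 <= x * 2 ^+ n by rewrite mulr_ge0 // ltW.
  have /andP[k1 k2] := truncn_itv x2n; set k := Num.trunc _ in k1 k2.
  have xk : k%:R / 2 ^+ n <= x < k.+1%:R / 2 ^+ n.
    by rewrite ler_pdivrMr // k1 ltr_pdivlMr.
  have kn : (k < 2 ^ n)%N.
    rewrite -(ltr_nat R) natrX; apply: le_lt_trans k1 _.
    by rewrite -[ltRHS]mul1r ltr_pM2r.
  rewrite /E -bigcup_mkord; exists k => //=.
  suff gk : good n k by rewrite /F gk /I /= in_itv.
  rewrite /good kn /=; apply/asboolP => z hz; apply: eU.
  rewrite (splitr e); apply: ball_triangle h1 _.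
  by rewrite (partial_rseries_dyadic lam xk); apply: le_ball hz; exact: ltW.
apply: (@le_trans _ _ (lebesgue_measure (\bigcup_N H N))).
  by apply: le_measure; rewrite ?inE.
have ndH : nondecreasing_seq H.
  move=> i j ij; apply/subsetPset => x Hx n /= jn; apply: Hx.
  exact: leq_trans jn.
have cH := nondecreasing_cvg_mu (mu := @lebesgue_measure R) mH mUH ndH.
rewrite -(cvg_lim _ cH) //; apply: lime_le; first by apply/cvg_ex; eexists; exact: cH.
apply: nearW => N; apply: le_trans (leE N).
apply: le_measure; rewrite ?inE; [exact: mH | exact: mE |].
by move=> x; apply => /=.
Qed.

(** Outer regularity is available for finite measures only, so it is applied to Lebesgue measure
    restricted to the squares [W k], which then exhaust the plane. *)
Lemma nu_le (A : set (R * R)) : measurable A ->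
  (nu lam A <= (2 / c)%:E * L2 R A)%E.
Proof.
move=> mA; rewrite -[L2 R A]/(L A).
have M0 : 0 < 2 / c by rewrite divr_gt0.
pose W (k : nat) : set (R * R) := ball (0, 0) k%:R.
have mW k : measurable (W k) by exact: measurable_ball_prod.
have LW k : (L (W k) < +oo)%E.
  by rewrite [X in (X < _)%E]L2_ball // ltry.
have bound k : (nu lam (A `&` W k) <= (2 / c)%:E * L A)%E.
  pose LWk : {finite_measure set (R * R)%type -> \bar R} := mfrestr (mW k) (LW k).
  have mAW : measurable (A `&` W k) by exact: measurableI.
  apply/lee_addgt0Pr => e e0.
  (* The tolerance [e / (2 / c)] becomes [e] after multiplication by [2 / c]. *)
  have [V [oV mV AV VA]] :=
    finite_measure_outer_regular LWk mA (divr_gt0 e0 M0).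
  have mVW : measurable (V `&` W k) by exact: measurableI.
  have mVA : measurable ((V `\` A) `&` W k) by apply: measurableI => //; exact: measurableD.
  apply: (@le_trans _ _ (nu_measure lam1 (V `&` W k))).
    by apply: (@le_measure _ _ _ (nu_measure lam1)); rewrite ?inE //; exact: setSI.
  apply: le_trans (nu_open_le _ mVW) _.
    by apply: openI => //; exact: ball_open.
  rewrite -[L2 R _]/(L _).
  apply: (@le_trans _ _ ((2 / c)%:E * (L A + (e / (2 / c))%:E))%E).
    rewrite lee_pmul2l //.
    apply: (@le_trans _ _ (L (A `|` ((V `\` A) `&` W k)))).
      apply: le_measure; rewrite ?inE //; first exact: measurableU.
      move=> z [Vz Wz]; have [Az|nAz] := pselect (A z); first by left.
      by right.
    apply: le_trans (measureU2 _ mA mVA) _.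
    by rewrite leeD2l // ltW.
  have eM0 : (0 <= (e / (2 / c))%:E)%E by rewrite lee_fin divr_ge0 // ltW.
  by rewrite ge0_muleDr // -EFinM [2 / c * _]mulrC divfK ?gt_eqF.
have ndW : nondecreasing_seq (fun k => A `&` W k).
  move=> i j ij; apply/subsetPset; apply: setIS; apply: le_ball.
  by rewrite ler_nat.
have UW : \bigcup_k (A `&` W k) = A.
  by rewrite -setI_bigcupr bigcup_ball_prod setIT.
have := nondecreasing_cvg_mu (mu := nu_measure lam1) (F := fun k => A `&` W k).
rewrite UW => /(_ (fun k => measurableI _ _ mA (mW k)) mA ndW) cA.
change (nu_measure lam1 A <= (2 / c)%:E * L A)%E; rewrite -(cvg_lim _ cA) //.
apply: lime_le; first by apply/cvg_ex; eexists; exact: cA.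
by apply: nearW => k; exact: bound.
Qed.

End Separated.

Theorem mainTheorem9 (R : realType) (theta : R[i]) (p : {poly int}) :
  complex_garsia theta ->
  int_minpoly p theta ->
  (p.[0] = 2 \/ p.[0] = -2) ->
  let lam := theta^-1 in
  (forall A : set (R * R), measurable A -> L2 R A = 0%E -> nu lam A = 0%E) /\
  exists f : R * R -> R,
    [/\ measurable_fun setT f,
        (exists M : R, forall z, 0 <= f z <= M)
      & forall A : set (R * R), measurable A ->
          nu lam A = (\int[L2 R]_(z in A) (f z)%:E)%E].
Proof.
move=> gtheta pmin p0 lam.
have p02 : `|p.[0]| = 2 by case: p0 => ->.
have [c c0 sep] := word_sum_separated gtheta pmin p02.
have lam1 : `|lam| < 1.
  by have [[_ [th1 _]] _] := gtheta; rewrite normfV invf_lt1 // (lt_trans _ th1).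
have le_nu := nu_le lam1 c0 sep.
split.
  move=> A mA A0; apply/eqP; rewrite -(measure_le0 (nu_measure lam1)).
  by apply: le_trans (le_nu _ mA) _; rewrite A0 mule0.
have M0 : 0 <= 2 / c by rewrite divr_ge0 // ltW.
(* The density is bounded by [2 / c], the ratio of the mass [2^(-n)] of a sign word to the area of
   its square. *)
have [f [mf fM fE]] := @bounded_density _ _ R
  (plane_lebesgue_measure R) (nu_measure lam1) _ M0 le_nu.
exists f; split; [exact: mf | by exists (2 / c) |] => A mA.
by rewrite integral_L2E ?fE // => z; have /andP[] := fM z.
Qed.
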